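(* Let $n\geq1$, $q\in(0,1)$, $t\in\mathbb{T}^n$ and $w\in W_n$, and let $V^{\mathrm{Spin}}_{t,w}$ be the associated simple unitarizable left $\mathcal{O}(\mathrm{Spin}_q(2n+1))$-module. Then $$\mathrm{GKdim}(V^{\mathrm{Spin}}_{t,w})=\ell(w).$$
   Context: Let $U=U_{q^{1/2}}(\mathfrak{so}_{2n+1})$ be the quantized universal enveloping algebra of $\mathfrak{so}_{2n+1}$ with standard generators $E_i,F_i,K_i$ ($1\le i\le n$) attached to the simple roots $\Pi=\{\alpha_1,\dots,\alpha_n\}$ ($\alpha_n$ short). $\mathcal{O}(\mathrm{Spin}_q(2n+1))$ denotes the Hopf $*$-algebra of matrix coefficients of finite-dimensional admissible unitarizable $U$-modules, generated by the matrix coefficients $x^i_j$ ($1\le i,j\le 2^n$) of the spin module of highest weight $(\tfrac12,\dots,\tfrac12)$ (it contains the matrix coefficients $v^k_l$ of the vector representation). $W_n$ is the Weyl group of $\mathfrak{so}_{2n+1}$ generated by simple reflections $s_1,\dots,s_n$; $\ell$ is the length function. Construction: for $1\le i\le n$ put $q_i=q^2$ if $i<n$, $q_n=q$. Let $\varphi_i:U_{q_i}(\mathfrak{sl}_2)\to U$, $E\mapsto E_i$, $F\mapsto F_i$, $K\mapsto K_i$, and $\varphi_i^*$ the dual surjection onto $\mathcal{O}(SU_{q_i}(2))$, generated by $\alpha,\beta$ with fundamental corepresentation $\begin{pmatrix}\alpha&-q_i\beta^*\\ \beta&\alpha^*\end{pmatrix}$. On $c_{00}(\mathbb{N})$ with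 basis $(e_k)_{k\ge0}$, $Se_k=e_{k-1}$ ($e_{-1}=0$), $Ne_k=ke_k$, $\pi(\alpha)=\sqrt{1-q_i^{2N+2}}S$, $\pi(\beta)=q_i^N$, and $\pi_{s_i}=\pi\circ\varphi_i^*$. $\mathbb{T}^n$ acts on a weight vector of weight $\sum_jm_j\varpi_j$ by $\prod_jt_j^{m_j}$; $\tau_t(C_{\omega,\upsilon})=(\omega,t\upsilon)$ is the associated one-dimensional representation. For representations $\eta,\gamma$, $\eta*\gamma=(\eta\otimes\gamma)\circ\Delta$. For a reduced expression $s_{i_1}\cdots s_{i_k}$ of $w$, $V^{\mathrm{Spin}}_{t,w}$ is $\mathbb{C}\otimes c_{00}(\mathbb{N})^{\otimes k}$ with the action $\tau_t*\pi_{s_{i_1}}*\cdots*\pi_{s_{i_k}}$ (independent of the reduced expression up to isomorphism). GKdim: for a finitely generated algebra $A$ and finitely generated left $A$-module $M$, $\mathrm{GKdim}(M)=\sup_{\xi,W}\limsup_{r\to\infty}\frac{\ln\dim(\xi^rW)}{\ln r}$, with $\xi$ ranging over finite generating subsets of $A$ containing $1$ and $W$ over finite-dimensional generating subspaces of $M$. *)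

(* Defs.v *)
From HB Require Import structures.
From mathcomp Require Import all_boot all_order all_algebra.
From mathcomp Require Import all_classical all_reals all_analysis.
From mathcomp Require Import complex.
Set Implicit Arguments.
Unset Strict Implicit.
Unset Printing Implicit Defensive.
Import Order.TTheory GRing.Theory Num.Theory.
Local Open Scope ring_scope.
Local Open Scope complex_scope.

(* Weyl group W_n of so_{2n+1} (signed permutations), acting on Z^n.  *)
(* Simple reflections (0-indexed): s_i (i < n-1) swaps coordinates    *)
(* i, i+1 (alpha_i = e_i - e_{i+1}); s_{n-1} negates coordinate n-1   *)
(* (alpha_n = e_n, the short root).                                   *)
Definition sref (n : nat) (i : 'I_n) (v : 'I_n -> int) : 'I_n -> int :=
  fun j =>
    if (i.+1 < n)%N then
      (if j == i :> nat then v ((insubd i i.+1))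
       else if j == i.+1 :> nat then v i else v j)
    else (if j == i then - v j else v j).

Definition wact (n : nat) (ws : seq 'I_n) (v : 'I_n -> int) : 'I_n -> int :=
  foldr (fun i acc => sref i acc) v ws.

Definition reduced_word (n : nat) (ws : seq 'I_n) : Prop :=
  forall ws' : seq 'I_n, (forall v, wact ws' v = wact ws v) ->
    (size ws <= size ws')%N.

(* The spin module: orthonormal weight basis v_eps, eps in {+-1/2}^n, *)
(* encoded as eps : {ffun 'I_n -> bool} (true = +1/2).                *)
Definition spin (n : nat) := {ffun 'I_n -> bool}.

(* coordinate m_j of the weight of v_eps in the basis of fundamental
   weights: m_j = eps_j - eps_{j+1} (j < n-1), m_{n-1} = 2 eps_{n-1} *)
Definition wcoord (n : nat) (e : spin n) (j : 'I_n) : int :=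
  if (j.+1 < n)%N then (e j)%:Z - (e ((insubd j j.+1)))%:Z
  else (if e j then 1 else -1).

(* pairing <eps, alpha_i^vee> in {-1,0,1} *)
Definition hwt (n : nat) (i : 'I_n) (e : spin n) : int := wcoord e i.

(* the partner of eps in its alpha_i-string (reflection s_i on weights) *)
Definition spartner (n : nat) (i : 'I_n) (e : spin n) : spin n :=
  if (i.+1 < n)%N then
    [ffun j : 'I_n => if j == i :> nat then e ((insubd i i.+1))
               else if j == i.+1 :> nat then e i else e j]
  else [ffun j : 'I_n => if j == i then ~~ e j else e j].

(* Elements of O(SU_q(2)) that occur as phi_i^*(x^a_b): the spin module
   restricted to U_{q_i}(sl_2) is a sum of trivial modules and copies of
   the fundamental module, whose matrix coefficients are
   ((alpha, -q_i beta^* ), (beta, alpha^* )) in the basis (v_high, v_low). *)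
Inductive sym := SZero | SOne | SAlpha | SAlphaS | SBeta | SmqBetaS.

(* phi_i^*(x^a_b), with x^a_b = < v_a , . v_b > *)
Definition phistar (n : nat) (i : 'I_n) (a b : spin n) : sym :=
  if hwt i a == 0 then (if a == b then SOne else SZero)
  else if a == b then (if hwt i a == 1 then SAlpha else SAlphaS)
  else if b == spartner i a then (if hwt i a == 1 then SmqBetaS else SBeta)
  else SZero.

Definition sym_star (s : sym) : sym :=
  match s with
  | SAlpha => SAlphaS | SAlphaS => SAlpha | s' => s'
  end.

Section Rep.
Variable R : realType.
Local Notation C := R[i].

(* vectors of C (x) c_00(N)^{(x) k} are finitely supported functions
   on N^k, here encoded as functions on seq nat supported on sequences
   of length k *)
Definition vec := seq nat -> C.
Definition op := vec -> vec.

(* the operator pi(s) of O(SU_{qi}(2)) on c_00(N), acting on the first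
   tensor factor:  pi(alpha) e_m = sqrt(1-qi^{2m}) e_{m-1},
   pi(alpha^* ) e_m = sqrt(1-qi^{2m+2}) e_{m+1}, pi(beta) e_m = qi^m e_m *)
Definition head_op (qi : R) (s : sym) (g : vec) : vec :=
  fun y => match y with
  | [::] => 0
  | m :: y' =>
    match s with
    | SZero => 0
    | SOne => g y
    | SAlpha => (Num.sqrt (1 - qi ^+ (2 * m.+1)))%:C * g (m.+1 :: y')
    | SAlphaS => match m with
                 | 0 => 0
                 | m'.+1 => (Num.sqrt (1 - qi ^+ (2 * m)))%:C * g (m' :: y')
                 end
    | SBeta => (qi ^+ m)%:C * g y
    | SmqBetaS => (- qi * qi ^+ m)%:C * g y
    end
  end.

Definition lift_op (T : op) : op :=
  fun g y => match y with
  | [::] => 0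
  | m :: y' => T (fun z => g (m :: z)) y'
  end.

Definition qpar (q : R) (n : nat) (i : 'I_n) : R :=
  if (i.+1 < n)%N then q ^+ 2 else q.

(* (pi_{s_{i_1}} * ... * pi_{s_{i_k}})(x^a_b), using
   Delta(x^a_b) = sum_c x^a_c (x) x^c_b; [st] selects the image of
   (x^a_b)^* instead of x^a_b *)
Fixpoint piw (q : R) (n : nat) (st : bool) (ws : seq 'I_n) (a b : spin n)
  : op :=
  match ws with
  | [::] => fun g => if a == b then g else (fun _ => 0)
  | i :: ws' => fun g y =>
      \sum_(c : spin n)
        head_op (qpar q i) (if st then sym_star (phistar i a c)
                            else phistar i a c)
                (lift_op (piw q st ws' c b) g) y
  end.

Definition tpow (n : nat) (t : 'I_n -> C) (a : spin n) : C :=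
  \prod_(j < n) t j ^ wcoord a j.

(* action of x^a_b (st = false) and of (x^a_b)^* (st = true) on
   V^Spin_{t,w} = C (x) c_00(N)^{(x) k} via tau_t * pi_{s_{i_1}} * ... *)
Definition spin_gen (q : R) (n : nat) (t : 'I_n -> C) (ws : seq 'I_n)
  (g : (spin n * spin n * bool)%type) : op :=
  let: (a, b, st) := g in
  fun f y => (if st then (tpow t a)^* else tpow t a) * piw q st ws a b f y.

Definition vcomb (m : nat) (c : 'I_m -> C) (u : 'I_m -> vec) : vec :=
  fun y => \sum_(j < m) c j * u j y.

Definition in_span (S : vec -> Prop) (v : vec) : Prop :=
  exists m (c : 'I_m -> C) (u : 'I_m -> vec),
    (forall j, S (u j)) /\ v = vcomb c u.

Definition lin_indep (m : nat) (u : 'I_m -> vec) : Prop :=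
  forall c : 'I_m -> C, vcomb c u = (fun _ => 0) -> forall j, c j = 0.

(* dimension of the span of S (meaningful when it is finite) *)
Definition dim_span (S : vec -> Prop) : nat :=
  xget 0%N [set d : nat |
     (exists u : 'I_d -> vec, lin_indep u /\ forall j, in_span S (u j)) /\
     (forall u : 'I_d.+1 -> vec, (forall j, in_span S (u j)) -> ~ lin_indep u)].

Definition opword (r : nat) (T : 'I_r -> op) : op :=
  foldr (fun j acc => T j \o acc) id (enum 'I_r).

Definition eq_on (M : vec -> Prop) (T T' : op) : Prop :=
  forall f, M f -> T f = T' f.

Definition in_alg (M : vec -> Prop) (I : finType) (xi : I -> op) (T : op)
  : Prop :=
  exists m (c : 'I_m -> C) (len : 'I_m -> nat)
         (w : forall j : 'I_m, 'I_(len j) -> I),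
    eq_on M T (fun f y => \sum_(j < m) c j * opword (fun l => xi (w j l)) f y).

Definition gen_subset (M : vec -> Prop) (I : finType) (gen : I -> op)
  (p : nat) (xi : 'I_p -> op) : Prop :=
  (forall j, in_alg M gen (xi j)) /\
  (forall T, in_alg M gen T -> in_alg M xi T) /\
  (exists j, eq_on M (xi j) id).

Definition gen_space (M : vec -> Prop) (I : finType) (gen : I -> op)
  (s : nat) (w : 'I_s -> vec) : Prop :=
  (forall j, M (w j)) /\
  (forall v, M v -> in_span (fun u => exists T j, in_alg M gen T /\ u = T (w j)) v).

Definition dim_pow (p : nat) (xi : 'I_p -> op) (s : nat) (w : 'I_s -> vec)
  (r : nat) : nat :=
  dim_span (fun u => exists (g : 'I_r -> 'I_p) (j : 'I_s),
                       u = opword (fun l => xi (g l)) (w j)).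

Definition GKdim (M : vec -> Prop) (I : finType) (gen : I -> op) : \bar R :=
  ereal_sup [set x : \bar R | exists p (xi : 'I_p -> op) s (w : 'I_s -> vec),
     [/\ gen_subset M gen xi, gen_space M gen w &
         x = limn_esup (fun r : nat =>
               ((ln (dim_pow xi w r)%:R / ln r%:R)%:E)%E)]].

Definition c00k (k : nat) (f : vec) : Prop :=
  exists supp : seq (seq nat),
    (forall y, size y = k -> y \notin supp -> f y = 0) /\
    (forall y, size y <> k -> f y = 0).

End Rep.

Definition GKdim_VSpin (R : realType) (q : R) (n : nat) (t : 'I_n -> R[i])
  (ws : seq 'I_n) : \bar R :=
  GKdim (@c00k R (size ws)) (spin_gen q t ws).

(* Main.v *)
Require Import Defs.
From HB Require Import structures.
From mathcomp Require Import all_boot all_order all_algebra.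
From mathcomp Require Import all_classical all_reals all_analysis.
From mathcomp Require Import complex.
From mathcomp Require Import zify ring.
Import Order.TTheory GRing.Theory Num.Theory.
Local Open Scope ring_scope.

(** Write w = s_{i_1} ... s_{i_k} (reduced), w_j = s_{i_{j+1}} ... s_{i_k}, and
    let beta_j = w_j^-1 alpha_{i_j}, which is a positive root.  Giving e_y the
    degree sum_j y_j beta_j makes the operator of (x^a_b)^* homogeneous of degree
    b - w^-1 a.  By induction on k every basis vector e_y with y <> 0 is a
    combination of vectors (x^a_b)^* e_z with e_z of smaller height: writing
    w = s w', unitarity of the 2x2 corepresentation of SU_q(2) transfers the
    statement from w' to the vectors e_m (x) e_y' with y' <> 0, up to terms which
    move height from the second factor to the first one, and the remaining
    e_m (x) e_0 are reached because w'^-1 alpha is not a nonnegative combination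
    of the roots beta_j of w'.  Hence words of length r in the generators applied
    to e_0 span all e_y of height at most r, which number at least c r^k; they
    also show that e_0 generates the module.  Conversely generators move the
    exponents y_j by a bounded amount, so words of length r stay in a box of
    size O(r)^k. *)

Set Implicit Arguments.
Unset Strict Implicit.
Unset Printing Implicit Defensive.

(** * Roots and the grading *)

Section Roots.
Variable n : nat.
Implicit Types (i j : 'I_n) (u v : 'I_n -> int) (ws : seq 'I_n).

Definition simple_root i : 'I_n -> int :=
  fun j => if j == i :> nat then 1 else if j == i.+1 :> nat then -1 else 0.

Definition coroot i v : int :=
  if (i.+1 < n)%N then v i - v (insubd i i.+1) else v i *+ 2.

Lemma srefE i v j : sref i v j = v j - coroot i v * simple_root i j.
Proof.
rewrite /sref /coroot /simple_root; case: ifP => hi.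
  case: eqP => [ji|ji].
    have -> : j = i by apply: val_inj.
    ring.
  case: eqP => [ji1|_]; last by ring.
  have -> : j = insubd i i.+1 by apply: val_inj; rewrite /= ji1 val_insubd hi.
  ring.
rewrite -[j == i]/(j == i :> nat); case: eqP => [ji|_].
  by rewrite (val_inj ji : j = i) mulr2n; ring.
case: eqP => [ji1|_]; last by ring.
by move: (ltn_ord j); rewrite ji1 hi.
Qed.

Definition dotz u v : int := \sum_j u j * v j.

Lemma dotz_simple_root i v : dotz v (simple_root i) *+ (i.+1 == n).+1 = coroot i v.
Proof.
rewrite /dotz /coroot (bigD1 i) //= {1}/simple_root eqxx mulr1.
case: ltnP => hi.
  set i1 := insubd i i.+1.
  have vi1 : i1 = i.+1 :> nat by rewrite val_insubd hi.
  rewrite ltn_eqF // (bigD1 i1) /=; last by rewrite -val_eqE /= vi1; lia.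
  rewrite big1 ?addr0 => [|j /andP[ji ji1]].
    by rewrite /simple_root vi1 eqxx ifF ?mulr1n; [ring|lia].
  have ji' : j != i :> nat by [].
  have ji1' : j != i1 :> nat by [].
  by rewrite /simple_root (negbTE ji') -vi1 (negbTE ji1') mulr0.
have -> : i.+1 == n by rewrite eqn_leq hi ltn_ord.
rewrite big1 ?addr0 // => j ji.
have ji' : j != i :> nat by [].
by rewrite /simple_root (negbTE ji') ifF ?mulr0 //; move: (ltn_ord j); lia.
Qed.

Lemma coroot_simple_root i : coroot i (simple_root i) = 2.
Proof.
rewrite /coroot /simple_root eqxx; case: ifP => hi; last by [].
by rewrite val_insubd hi eqxx ifF ?opprK //; lia.
Qed.

Lemma coroot_lin i c u v :
  coroot i (fun j => u j + c * v j) = coroot i u + c * coroot i v.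
Proof. by rewrite /coroot; case: ifP => _; rewrite ?mulr2n; ring. Qed.

Lemma sref_lin i c u v :
  sref i (fun j => u j + c * v j) = fun j => sref i u j + c * sref i v j.
Proof. by apply/funext => j; rewrite !srefE coroot_lin; ring. Qed.

Lemma srefK i v : sref i (sref i v) = v.
Proof.
apply/funext => j; rewrite [LHS]srefE.
have -> : sref i v = fun j => v j + (- coroot i v) * simple_root i j.
  by apply/funext => k; rewrite srefE; ring.
by rewrite coroot_lin coroot_simple_root; ring.
Qed.

Lemma wact_cat ws1 ws2 v : wact (ws1 ++ ws2) v = wact ws1 (wact ws2 v).
Proof. by rewrite /wact foldr_cat. Qed.

Lemma wact_rev_cons i ws v : wact (rev (i :: ws)) v = wact (rev ws) (sref i v).
Proof. by rewrite rev_cons -cats1 wact_cat. Qed.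

Lemma wact_lin ws c u v :
  wact ws (fun j => u j + c * v j) = fun j => wact ws u j + c * wact ws v j.
Proof. by elim: ws => //= i ws ->; rewrite sref_lin. Qed.

Lemma wact0 ws : wact ws (fun=> 0) = fun=> 0.
Proof.
elim: ws => //= i ws ->; apply/funext => j.
by rewrite srefE /coroot; case: ifP => _; rewrite ?mul0rn ?subr0 mul0r subr0.
Qed.

Lemma wactZ ws c v : wact ws (fun j => c * v j) = fun j => c * wact ws v j.
Proof.
have := wact_lin ws c (fun=> 0) v; rewrite wact0.
under eq_fun do rewrite add0r.
by move=> ->; apply/funext => j; rewrite add0r.
Qed.

Lemma wact_revK ws v : wact (rev ws) (wact ws v) = v.
Proof. by elim: ws v => //= i ws IH v; rewrite wact_rev_cons srefK IH. Qed.

Lemma wactK_rev ws v : wact ws (wact (rev ws) v) = v.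
Proof. by rewrite -{1}(revK ws) wact_revK. Qed.

Lemma dotz_sref i u v : dotz (sref i u) (sref i v) = dotz u v.
Proof.
have e w w' : dotz (sref i w) w' = dotz w w' - coroot i w * dotz w' (simple_root i).
  rewrite /dotz mulr_sumr -sumrB; apply: eq_bigr => j _; rewrite srefE; ring.
have dC w w' : dotz w w' = dotz w' w.
  by apply: eq_bigr => j _; rewrite mulrC.
rewrite e (dC u) e (dC v).
have -> : dotz (sref i v) (simple_root i) = - dotz v (simple_root i).
  rewrite e -!dotz_simple_root.
  have := coroot_simple_root i; rewrite -dotz_simple_root.
  case: (i.+1 == n) => /=; rewrite ?mulr1n ?mulr2n => h; nia.
rewrite -!dotz_simple_root; ring.
Qed.

Lemma dotz_wact ws u v : dotz (wact ws u) (wact ws v) = dotz u v.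
Proof. by elim: ws => //= i ws IH; rewrite dotz_sref. Qed.

Definition height v : int := \sum_(j < n) (n - j)%:Z * v j.

Lemma height_lin c u v : height (fun j => u j + c * v j) = height u + c * height v.
Proof.
rewrite /height mulr_sumr -big_split /=; apply: eq_bigr => j _; ring.
Qed.

Definition pos_root v : Prop :=
  dotz v v <= 2 /\ exists2 p : 'I_n, 0 < v p & forall j, (j < p)%N -> v j = 0.

Lemma dotz_two_le v (p r : 'I_n) : p != r -> v p * v p + v r * v r <= dotz v v.
Proof.
move=> pr; rewrite /dotz (bigD1 p) //= lerD2l (bigD1 r) /=; last by rewrite eq_sym.
by rewrite lerDl sumr_ge0 // => j _; rewrite -expr2 sqr_ge0.
Qed.

Lemma height_pos_root v : pos_root v -> 0 < height v.
Proof.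
move=> [nv [p vp z]].
have := nv; rewrite /dotz /height (bigD1 p) //= [X in _ -> _ < X](bigD1 p) //= => h.
have hp := ltn_ord p.
have : - ((n - p).-1)%:Z * \sum_(j < n | j != p) v j * v j <= \sum_(j < n | j != p) (n - j)%:Z * v j.
  rewrite mulr_sumr; apply: ler_sum => j jp.
  have [jlp|] := ltnP j p; first by rewrite z // !mulr0.
  rewrite leq_eqVlt => /orP[/eqP e|pj].
    by move: jp; rewrite -val_eqE /= e eqxx.
  have hj := ltn_ord j.
  have : (n - j)%:Z <= ((n - p).-1)%:Z by lia.
  have : 0 <= (n - j)%:Z by lia.
  move: (n - j)%:Z ((n - p).-1)%:Z (v j) => a b x a0 ab.
  have xx : 0 <= x * x by nia.
  have x1 : 0 <= x * x + x by nia.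
  have : a * (x * x) <= b * (x * x) by nia.
  have : 0 <= a * (x * x + x) by nia.
  nia.
have : 0 <= \sum_(j < n | j != p) v j * v j.
  by apply: sumr_ge0 => j _; rewrite -expr2 sqr_ge0.
have -> : (n - p)%:Z = ((n - p).-1)%:Z + 1 by lia.
move: h vp; move: (\sum_(j < n | j != p) v j * v j) (\sum_(j < n | j != p) (n - j)%:Z * v j)
  ((n - p).-1) (v p) => S T a x h x0 S0 hT.
have x1 : 1 <= x * x by nia.
have S1 : S <= 1 by lia.
have a0 : 0 <= a%:Z by [].
have : a%:Z * S <= a%:Z * 1 by apply: ler_wpM2l.
have : a%:Z * 1 <= a%:Z * x by apply: ler_wpM2l => //; lia.
move: hT; rewrite mulrDl mul1r mulNr; move: (a%:Z * S) (a%:Z * x); lia.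
Qed.

Lemma pos_simple_root i : pos_root (simple_root i).
Proof.
split.
  have := coroot_simple_root i; rewrite -dotz_simple_root; case: (_ == _) => /=; rewrite ?mulr2n ?mulr1n; lia.
exists i => [|j ji]; rewrite /simple_root ?eqxx // ltn_eqF // ifF //; lia.
Qed.

Lemma pos_root_sref i v : pos_root v -> ~ pos_root (sref i v) -> v = simple_root i.
Proof.
move=> [nv [p vp z]] npos.
have nsv : dotz (sref i v) (sref i v) <= 2 by rewrite dotz_sref.
have {}npos (r : 'I_n) : 0 < sref i v r -> exists2 j : 'I_n, (j < r)%N & sref i v j != 0.
  move=> r0; apply/not_exists2P => h; apply: npos; split => //; exists r => // j jr.
  by have [//|/negP] := h j; rewrite negbK => /eqP.
have [hi|hi] := ltnP i.+1 n.
  set i1 : 'I_n := insubd i i.+1.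
  have vi1 : i1 = i.+1 :> nat by rewrite val_insubd hi.
  have ni1 : i != i1 by rewrite -val_eqE /= vi1; lia.
  have sE j : sref i v j = if j == i :> nat then v i1
                           else if j == i1 :> nat then v i else v j.
    by rewrite /sref hi vi1.
  have szero j : (j < i)%N -> (j < p)%N -> sref i v j = 0.
    by move=> ji jp; rewrite sE !ifF ?z //; lia.
  have [pi|pi] := eqVneq p i; last first.
    have pi' : p != i :> nat by [].
    exfalso; have [pi1|pi1] := eqVneq p i1.
      have [|j ji] := npos i; first by rewrite sE eqxx -pi1.
      by rewrite szero ?eqxx // pi1; lia.
    have pi1' : p != i1 :> nat by [].
    have [|j jp] := npos p; first by rewrite sE (negbTE pi') (negbTE pi1').
    rewrite sE; case: (nat_of_ord j =P i) => [ji|_]; first by rewrite z ?eqxx //; lia.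
    by case: (nat_of_ord j =P i1) => [ji|_]; rewrite z ?eqxx //; lia.
  subst p.
  have vi1lt : v i1 < 0.
    rewrite ltNge le_eqVlt; apply/negP => /orP[/eqP v0|v0].
      have [|j ji] := npos i1; first by rewrite sE vi1 eqxx ifF //; lia.
      rewrite sE; case: (nat_of_ord j =P i) => [_|?]; first by rewrite -v0 eqxx.
      by rewrite ifF ?z ?eqxx //; lia.
    have [|j ji] := npos i; first by rewrite sE eqxx.
    by rewrite szero ?eqxx.
  have vs := dotz_two_le v ni1.
  have vi : v i = 1 by nia.
  have vi1' : v i1 = -1 by nia.
  apply/funext => j; rewrite /simple_root.
  case: eqP => [/val_inj->//|/eqP ji]; case: eqP => [ji1|/eqP ji1].
    by rewrite -vi1'; congr v; apply: val_inj; rewrite /= vi1.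
  have {}ji1 : j != i1 by rewrite -(inj_eq val_inj) /= vi1.
  move: nv; rewrite /dotz (bigD1 i) //= (bigD1 i1) /=; last by rewrite eq_sym.
  rewrite (bigD1 j) /= ?ji //.
  have : 0 <= \sum_(i0 | (i0 != i) && (i0 != i1) && (i0 != j)) v i0 * v i0.
    by apply: sumr_ge0 => r _; rewrite -expr2 sqr_ge0.
  rewrite vi vi1'; move: (\sum_(_ | _) _) => S S0; nia.
have sE j : sref i v j = if j == i then - v j else v j by rewrite /sref ltnNge hi.
have ilast (j : 'I_n) : (j <= i)%N by move: (ltn_ord j); lia.
have pi : p = i.
  apply/eqP; apply: contraT => pi; exfalso.
  have [|j jp] := npos p; first by rewrite sE (negbTE pi).
  have pi' : p != i :> nat by [].
  by have := ilast p; rewrite sE; case: (j =P i) => [ji|_]; [subst j; lia|rewrite z // eqxx].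
subst p; apply/funext => j; rewrite /simple_root.
case: eqP => [/val_inj->|/eqP ji].
  move: nv; rewrite /dotz (bigD1 i) //=.
  have : 0 <= \sum_(i0 | i0 != i) v i0 * v i0.
    by apply: sumr_ge0 => r _; rewrite -expr2 sqr_ge0.
  move: (\sum_(_ | _) _) => S S0; nia.
have := ilast j; rewrite ifF; last by move: (ltn_ord j); lia.
by move=> ?; apply: z; lia.
Qed.

Lemma reduced_consr i ws : reduced_word (i :: ws) -> reduced_word ws.
Proof.
by move=> red ws' h; apply: (red (i :: ws')) => v /=; rewrite h.
Qed.

Lemma reduced_rev ws : reduced_word ws -> reduced_word (rev ws).
Proof.
move=> red ws' h; rewrite size_rev -(size_rev ws'); apply: red => v.
by rewrite -[in LHS](wact_revK ws v) -h wact_revK.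
Qed.

Lemma wact_conj i j us v : wact us (simple_root i) = simple_root j ->
  wact us (sref i v) = sref j (wact us v).
Proof.
move=> e.
have cE : coroot i v = coroot j (wact us v).
  have dd : dotz (simple_root i) (simple_root i) = dotz (simple_root j) (simple_root j).
    by rewrite -e dotz_wact.
  have := coroot_simple_root i; have := coroot_simple_root j.
  rewrite -!dotz_simple_root -dd -e dotz_wact.
  case: (i.+1 == n); case: (j.+1 == n) => //=; rewrite ?mulr2n ?mulr1n; nia.
have -> : sref i v = fun k => v k + (- coroot i v) * simple_root i k.
  by apply/funext => k; rewrite srefE; ring.
by rewrite wact_lin e cE; apply/funext => k; rewrite srefE; ring.
Qed.

(* If a suffix [j :: us] first makes the root negative, then [s_j us s_i = us],
   so the word can be shortened by two letters. *)
Lemma reduced_pos_root us i vs :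
  reduced_word (us ++ i :: vs) -> pos_root (wact us (simple_root i)).
Proof.
elim: us => [|j us IH] red; first exact: pos_simple_root.
have {}IH := IH (reduced_consr red).
apply: contrapT => /(pos_root_sref IH) e.
suff : (size (j :: us ++ i :: vs) <= size (us ++ vs))%N.
  by rewrite /= !size_cat /=; lia.
apply: red => v; rewrite /= !wact_cat /= -(wact_conj _ e) srefK //.
Qed.

Fixpoint deg ws (y : seq nat) : 'I_n -> int :=
  match ws, y with
  | i :: ws', m :: y' =>
      fun j => deg ws' y' j + m%:Z * wact (rev ws') (simple_root i) j
  | _, _ => fun=> 0
  end.

Lemma height_root_pos i ws : reduced_word (i :: ws) ->
  0 < height (wact (rev ws) (simple_root i)).
Proof.
move=> /reduced_rev; rewrite rev_cons -cats1 => /reduced_pos_root.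
exact: height_pos_root.
Qed.

Lemma height0 : height (fun=> 0) = 0.
Proof. by rewrite /height big1 // => j _; rewrite mulr0. Qed.

Lemma height_deg_ge0 ws y : reduced_word ws -> 0 <= height (deg ws y).
Proof.
elim: ws y => [|i ws IH] [|m y] red; rewrite /= ?height0 //.
rewrite height_lin; apply: addr_ge0; first exact/IH/(reduced_consr red).
by apply: mulr_ge0 => //; exact/ltW/height_root_pos.
Qed.

Lemma height_deg_eq0 ws y : reduced_word ws -> size y = size ws ->
  height (deg ws y) = 0 -> y = nseq (size ws) 0%N.
Proof.
elim: ws y => [|i ws IH] [|m y] red //= [sz].
have red' := reduced_consr red.
rewrite height_lin; have := height_deg_ge0 y red'; have := height_root_pos red.
move: (height (wact _ _)) => g g0 h0 hh.
have m0 : m = 0%N by nia.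
by rewrite m0 (IH y) // ; nia.
Qed.

Lemma height_wact_deg us ws y : reduced_word (us ++ ws) ->
  height (wact (us ++ ws) (deg ws y)) <= 0.
Proof.
elim: ws us y => [|i ws IH] us [|m y] red; rewrite ?wact0 ?height0 //=.
rewrite wact_cat /= !wact_lin wactK_rev sref_lin wact_lin height_lin.
have red' : reduced_word (rcons us i ++ ws) by rewrite cat_rcons.
have := IH (rcons us i) y red'; rewrite cat_rcons wact_cat /= => h.
have -> : sref i (simple_root i) = fun j => -1 * simple_root i j.
  by apply/funext => j; rewrite srefE coroot_simple_root; ring.
rewrite wactZ.
have -> : (fun j => -1 * wact us (simple_root i) j) =
  fun j => 0 + -1 * wact us (simple_root i) j by apply/funext => j; rewrite add0r.
rewrite height_lin height0.
have := height_pos_root (reduced_pos_root red); nia.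
Qed.

(* [w] turns the left-hand side into a nonpositive combination of positive
   roots, and the right-hand side into a simple root. *)
Lemma deg_neq_root i ws y : reduced_word (i :: ws) ->
  ~ (forall j, deg ws y j = wact (rev ws) (simple_root i) j).
Proof.
move=> red /funext e; have := @height_wact_deg [::] ws y (reduced_consr red).
rewrite /= e wactK_rev leNgt; apply/negP; rewrite negbK.
exact/height_pos_root/pos_simple_root.
Qed.

End Roots.

Section SpinWeights.
Variable n : nat.
Implicit Types (i j : 'I_n) (a b : spin n).

Definition sgn_weight a : 'I_n -> int := fun j => if a j then 1 else -1.

Lemma sgn_weight_inj : injective sgn_weight.
Proof.
by move=> a b /funeqP e; apply/ffunP => j; have := e j; rewrite /sgn_weight; do 2!case: ifP.
Qed.

Lemma coroot_sgn_weight i a : coroot i (sgn_weight a) = hwt i a *+ 2.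
Proof.
rewrite /coroot /hwt /wcoord /sgn_weight; case: ifP => _; last by case: ifP.
by do 2!case: (a _).
Qed.

Lemma sgn_weight_spartner i a : sgn_weight (spartner i a) = sref i (sgn_weight a).
Proof.
apply/funext => j; rewrite /sgn_weight /spartner /sref; case: (ltnP i.+1 n) => _; rewrite ffunE.
  by case: (nat_of_ord j == i) => //; case: (nat_of_ord j == i.+1).
by case: (j == i) => //; case: (a j).
Qed.

Lemma spartnerK i a : spartner i (spartner i a) = a.
Proof. by apply: sgn_weight_inj; rewrite !sgn_weight_spartner srefK. Qed.

Lemma sref_sgn_weight i a :
  sref i (sgn_weight a) = fun j => sgn_weight a j + (- (hwt i a *+ 2)) * simple_root i j.
Proof. by apply/funext => j; rewrite srefE coroot_sgn_weight; ring. Qed.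

Lemma hwt_spartner i a : hwt i (spartner i a) = - hwt i a.
Proof.
have := coroot_sgn_weight i (spartner i a); rewrite sgn_weight_spartner.
have -> : sref i (sgn_weight a) = fun j => sgn_weight a j + (- (hwt i a *+ 2)) * simple_root i j.
  exact: sref_sgn_weight.
rewrite coroot_lin coroot_simple_root coroot_sgn_weight; lia.
Qed.

Lemma hwtP i a : [\/ hwt i a = 0, hwt i a = 1 | hwt i a = -1].
Proof.
rewrite /hwt /wcoord; case: ifP => _; last by case: (a i); [apply: Or32|apply: Or33].
by case: (a i); case: (a _); [apply: Or31|apply: Or32|apply: Or33|apply: Or31].
Qed.

Lemma spartner_neq i a : hwt i a != 0 -> spartner i a != a.
Proof.
move=> h; apply/eqP => e; have := hwt_spartner i a; rewrite e; lia.
Qed.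

Lemma exists_hwt1 i : exists a : spin n, hwt i a = 1.
Proof.
exists [ffun j => j == i]; rewrite /hwt /wcoord !ffunE eqxx; case: ifP => // hi.
by rewrite -(inj_eq val_inj) /= val_insubd hi /= gtn_eqF.
Qed.

Lemma exists_wact_sgn_weight ws a :
  exists b : spin n, sgn_weight b = wact (rev ws) (sgn_weight a).
Proof.
elim: ws a => [|i ws IH] a; first by exists a.
by have [b e] := IH (spartner i a); exists b; rewrite wact_rev_cons e sgn_weight_spartner.
Qed.

End SpinWeights.

Section Spans.
Local Open Scope complex_scope.
Variable R : realType.
Local Notation C := R[i].
Implicit Types (u v : vec R) (S : vec R -> Prop).

Lemma in_span_mem S v : S v -> in_span S v.
Proof.
move=> Sv; exists 1%N, (fun=> 1), (fun=> v); split => //.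
by apply/funext => y; rewrite /vcomb big_ord1 mul1r.
Qed.

Lemma in_span0 S : in_span S (fun=> 0).
Proof.
exists 0%N, (fun=> 0), (fun _ _ => 0); split => [[]//|].
by apply/funext => y; rewrite /vcomb big_ord0.
Qed.

Lemma in_spanZD S c u v : in_span S u -> in_span S v ->
  in_span S (fun y => c * u y + v y).
Proof.
move=> [m1 [c1 [u1 [S1 ->]]]] [m2 [c2 [u2 [S2 ->]]]].
exists (m1 + m2)%N, (fun j => match fintype.split j with inl k => c * c1 k | inr k => c2 k end),
  (fun j => match fintype.split j with inl k => u1 k | inr k => u2 k end).
split=> [j|]; first by case: (fintype.split j).
apply/funext => y; rewrite /vcomb big_split_ord /= mulr_sumr; congr (_ + _).
  by apply: eq_bigr => j _; rewrite (unsplitK (inl j)) mulrA.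
by apply: eq_bigr => j _; rewrite (unsplitK (inr j)).
Qed.

Lemma in_spanZ S c u : in_span S u -> in_span S (fun y => c * u y).
Proof.
move=> /(in_spanZD c)/(_ (in_span0 S)).
by under [X in in_span _ X]eq_fun do rewrite addr0.
Qed.

Lemma in_span_vcomb S m (c : 'I_m -> C) (u : 'I_m -> vec R) :
  (forall j, in_span S (u j)) -> in_span S (vcomb c u).
Proof.
elim: m c u => [|m IH] c u Su.
  have -> : vcomb c u = fun=> 0 by apply/funext => y; rewrite /vcomb big_ord0.
  exact: in_span0.
have -> : vcomb c u = fun y => c ord0 * u ord0 y
     + vcomb (fun j => c (lift ord0 j)) (fun j => u (lift ord0 j)) y.
  by apply/funext => y; rewrite /vcomb big_ord_recl.
by apply: in_spanZD => //; apply: IH.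
Qed.

Lemma in_span_trans S S' v :
  (forall u, S u -> in_span S' u) -> in_span S v -> in_span S' v.
Proof.
by move=> SS' [m [c [u [Su ->]]]]; apply: in_span_vcomb => j; apply: SS'.
Qed.

Definition linop (T : op R) : Prop :=
  forall c u v, T (fun y => c * u y + v y) = fun y => c * T u y + T v y.

Lemma linop0 T : linop T -> T (fun=> 0) = fun=> 0.
Proof.
move=> lT; have := lT (-1) (fun=> 0) (fun=> 0).
under eq_fun do rewrite mulr0 addr0.
by move=> {1}->; apply/funext => y; rewrite mulN1r addNr.
Qed.

Lemma linop_vcomb T m (c : 'I_m -> C) (u : 'I_m -> vec R) : linop T ->
  T (vcomb c u) = vcomb c (fun j => T (u j)).
Proof.
move=> lT; elim: m c u => [|m IH] c u.
  have e (w : 'I_0 -> vec R) : vcomb c w = fun=> 0.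
    by apply/funext => y; rewrite /vcomb big_ord0.
  by rewrite !e linop0.
have e (w : 'I_m.+1 -> vec R) : vcomb c w = fun y => c ord0 * w ord0 y
     + vcomb (fun j => c (lift ord0 j)) (fun j => w (lift ord0 j)) y.
  by apply/funext => y; rewrite /vcomb big_ord_recl.
by rewrite !e lT IH.
Qed.

Lemma in_span_linop T S S' v : linop T ->
  (forall u, S u -> in_span S' (T u)) -> in_span S v -> in_span S' (T v).
Proof.
move=> lT SS' [m [c [u [Su ->]]]]; rewrite linop_vcomb //.
by apply: in_span_vcomb => j; apply: SS'.
Qed.

Definition delta (z : seq nat) : vec R := fun y => (y == z)%:R.

Lemma in_span_delta (s : seq (seq nat)) v : (forall y, v y != 0 -> y \in s) ->
  in_span (fun u => exists2 y, v y != 0 & u = delta y) v.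
Proof.
move=> vs; pose s' := undup [seq y <- s | v y != 0].
exists (size s'), (fun j => v (nth [::] s' j)), (fun j => delta (nth [::] s' j)).
split=> [j|].
  exists (nth [::] s' j) => //.
  by have := mem_nth [::] (ltn_ord j); rewrite mem_undup mem_filter => /andP[].
apply/funext => y; rewrite /vcomb.
rewrite -(big_mkord xpredT (fun j => v (nth [::] s' j) * delta (nth [::] s' j) y)).
rewrite -(big_nth [::] xpredT (fun z => v z * delta z y)) /delta.
have [y0|y0] := eqVneq (v y) 0.
  rewrite y0 big1_seq // => z _; case: eqP => [<-|_]; by rewrite ?y0 ?mul0r ?mulr0.
have ys : y \in s' by rewrite mem_undup mem_filter y0 vs.
rewrite (bigD1_seq y) ?undup_uniq //= eqxx mulr1 big1 ?addr0 // => z zy.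
by rewrite eq_sym (negbTE zy) mulr0.
Qed.

Definition consv (m : nat) v : vec R :=
  fun y => if y is m' :: y' then (if m' == m then v y' else 0) else 0.

Lemma delta_cons m z : delta (m :: z) = consv m (delta z).
Proof.
by apply/funext => -[|m' y] //=; rewrite /delta eqseq_cons; case: eqP.
Qed.

Lemma linop_consv m : linop (consv m).
Proof.
by move=> c u v; apply/funext => -[|m' y] /=; rewrite ?mulr0 ?addr0 //; case: eqP; rewrite ?mulr0 ?addr0.
Qed.

Fixpoint box (k L : nat) : seq (seq nat) :=
  if k is k'.+1 then [seq m :: y | m <- iota 0 L.+1, y <- box k' L] else [:: [::]].

Lemma boxS k L : box k.+1 L = [seq m :: y | m <- iota 0 L.+1, y <- box k L].
Proof. by []. Qed.

Lemma size_box k L : size (box k L) = (L.+1 ^ k)%N.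
Proof. by elim: k => // k IH; rewrite boxS size_allpairs IH size_iota expnS. Qed.

Lemma mem_box k L y : (y \in box k L) = (size y == k) && all (fun m => m <= L)%N y.
Proof.
elim: k y => [|k IH] [|m y] //; rewrite boxS.
  by apply/negbTE/negP => /allpairsP[[? ?] /= [_ _]].
rewrite [size _]/= eqSS [all _ _]/=; apply/allpairsP/idP => [[[m' y'] [+ + [-> ->]]]|].
  by rewrite IH mem_iota /= add0n ltnS => -> /andP[-> ->].
by move=> /and3P[sy mL yL]; exists (m, y); split=> //; rewrite ?mem_iota ?IH ?sy ?yL.
Qed.

End Spans.

(** * The action on basis vectors *)

Section Piw.
Local Open Scope complex_scope.
Variables (R : realType) (q : R) (n : nat).
Hypothesis q01 : 0 < q < 1.
Local Notation C := R[i].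
Implicit Types (i : 'I_n) (a b c : spin n) (ws : seq 'I_n) (u v : vec R).

Lemma linop_head_op r s : linop (@head_op R r s).
Proof.
move=> c u v; apply/funext => -[|m y] /=; first by rewrite mulr0 addr0.
case: s; [ | |  |case: m => [|m] | | ] => /=; ring.
Qed.

Lemma linop_lift_op (T : op R) : linop T -> linop (lift_op T).
Proof.
move=> lT c u v; apply/funext => -[|m y] /=; first by rewrite mulr0 addr0.
by rewrite (lT c (fun z => u (m :: z))).
Qed.

Lemma linop_piw st ws a b : linop (piw q st ws a b).
Proof.
elim: ws a => [|i ws IH] a c u v /=; apply/funext => y.
  by case: eqP => _; rewrite ?mulr0 ?addr0.
rewrite mulr_sumr -big_split /=; apply: eq_bigr => d _.
by rewrite linop_lift_op // linop_head_op.
Qed.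

Definition rsqrt (r : R) m : C := (Num.sqrt (1 - r ^+ (2 * m)))%:C.

Lemma qpar_itv i : 0 < qpar q i < 1.
Proof.
have /andP[q0 q1] := q01; rewrite /qpar; case: ifP => // _.
by rewrite exprn_gt0 //= exprn_ilt1 // ltW.
Qed.

Lemma rsqrt_sqr i m : rsqrt (qpar q i) m * rsqrt (qpar q i) m
  = 1 - ((qpar q i) ^+ m)%:C * ((qpar q i) ^+ m)%:C.
Proof.
have /andP[q0 q1] := qpar_itv i.
rewrite /rsqrt -!rmorphM /= -expr2 sqr_sqrtr; last first.
  by rewrite subr_ge0 exprn_ile1 // ltW.
by rewrite rmorphB rmorph1 -exprD addnn mul2n.
Qed.

Lemma rsqrt_neq0 i m : rsqrt (qpar q i) m.+1 != 0.
Proof.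
have /andP[q0 q1] := qpar_itv i.
rewrite fmorph_eq0 gt_eqF // sqrtr_gt0 subr_gt0 exprn_ilt1 // ltW //.
Qed.

Lemma qpow_neq0 i m : (((qpar q i) ^+ m)%:C : C) != 0.
Proof.
have /andP[q0 q1] := qpar_itv i.
by rewrite fmorph_eq0 expf_neq0 // gt_eqF.
Qed.

Lemma head_SAlpha r (T : op R) m v : linop T ->
  head_op r SAlpha (lift_op T (consv m v)) =
  fun y => if m is m'.+1 then rsqrt r m * consv m' (T v) y else 0.
Proof.
move=> lT; apply/funext => -[|k y] /=; first by case: m => // m; rewrite mulr0.
case: m => [|m]; first by rewrite /= linop0 // mulr0.
rewrite eqSS; case: eqP => [->//|_].
by rewrite linop0 // !mulr0.
Qed.

Lemma head_SAlphaS r (T : op R) m v : linop T ->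
  head_op r SAlphaS (lift_op T (consv m v)) =
  fun y => rsqrt r m.+1 * consv m.+1 (T v) y.
Proof.
move=> lT; apply/funext => -[|[|k] y] /=; rewrite ?mulr0 // eqSS.
by case: eqP => [->//|_]; rewrite linop0 // !mulr0.
Qed.

Lemma head_SOne r (T : op R) m v : linop T ->
  head_op r SOne (lift_op T (consv m v)) = consv m (T v).
Proof.
by move=> lT; apply/funext => -[|k y] //=; case: eqP => [_|_] //; rewrite linop0.
Qed.

Lemma head_SBeta r (T : op R) m v : linop T ->
  head_op r SBeta (lift_op T (consv m v)) = fun y => (r ^+ m)%:C * consv m (T v) y.
Proof.
move=> lT; apply/funext => -[|k y] /=; rewrite ?mulr0 //.
by case: eqP => [->//|_]; rewrite linop0 // !mulr0.
Qed.

Lemma head_SmqBetaS r (T : op R) m v : linop T ->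
  head_op r SmqBetaS (lift_op T (consv m v)) =
  fun y => - (r ^+ m.+1)%:C * consv m (T v) y.
Proof.
move=> lT; apply/funext => -[|k y] /=; rewrite ?mulr0 //.
by case: eqP => [->|_]; rewrite ?linop0 // ?mulr0 // mulNr rmorphN exprS.
Qed.

Lemma phistar_diag i a : hwt i a != 0 ->
  phistar i a a = if hwt i a == 1 then SAlpha else SAlphaS.
Proof. by move=> h; rewrite /phistar (negbTE h) eqxx. Qed.

Lemma phistar_partner i a : hwt i a != 0 ->
  phistar i a (spartner i a) = if hwt i a == 1 then SmqBetaS else SBeta.
Proof.
by move=> h; rewrite /phistar (negbTE h) eqxx eq_sym (negbTE (spartner_neq h)).
Qed.

Lemma phistar_other i a c : c != a -> (hwt i a != 0 -> c != spartner i a) ->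
  phistar i a c = SZero.
Proof.
rewrite /phistar [a == c]eq_sym => /negbTE ->; case: eqP => //= _ h.
by rewrite (negbTE (h isT)).
Qed.

Lemma piw_hwt0 i ws a b m v : hwt i a = 0 ->
  piw q true (i :: ws) a b (consv m v) = consv m (piw q true ws a b v).
Proof.
move=> h; apply/funext => y /=; rewrite (bigD1 a) //= big1 => [|c ca].
  by rewrite /phistar h !eqxx /= head_SOne ?addr0 //; apply: linop_piw.
by rewrite phistar_other ?h //=; case: y.
Qed.

Lemma piw_hwt1 i ws a b m v : hwt i a = 1 ->
  piw q true (i :: ws) a b (consv m v) =
  fun y => rsqrt (qpar q i) m.+1 * consv m.+1 (piw q true ws a b v) y
         - ((qpar q i) ^+ m.+1)%:C * consv m (piw q true ws (spartner i a) b v) y.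
Proof.
move=> h; have h0 : hwt i a != 0 by rewrite h.
apply/funext => y /=; rewrite (bigD1 a) //= (bigD1 (spartner i a)) ?spartner_neq //=.
rewrite big1 ?addr0 => [|c /andP[ca cs]]; last by rewrite phistar_other //=; case: y.
rewrite phistar_diag // phistar_partner // h /= head_SAlphaS; last exact: linop_piw.
by rewrite head_SmqBetaS ?mulNr //; apply: linop_piw.
Qed.

Lemma piw_hwtN1 i ws a b m v : hwt i a = -1 ->
  piw q true (i :: ws) a b (consv m v) =
  fun y => (if m is m'.+1
            then rsqrt (qpar q i) m * consv m' (piw q true ws a b v) y else 0)
         + ((qpar q i) ^+ m)%:C * consv m (piw q true ws (spartner i a) b v) y.
Proof.
move=> h; have h0 : hwt i a != 0 by rewrite h.
apply/funext => y /=; rewrite (bigD1 a) //= (bigD1 (spartner i a)) ?spartner_neq //=.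
rewrite big1 ?addr0 => [|c /andP[ca cs]]; last by rewrite phistar_other //=; case: y.
rewrite phistar_diag // phistar_partner // h /= head_SAlpha; last exact: linop_piw.
by rewrite head_SBeta //; apply: linop_piw.
Qed.

Definition supp_box k L v := forall y, v y != 0 -> y \in box k L.

Lemma piw_box st ws a b L v : supp_box (size ws) L v ->
  supp_box (size ws) L.+1 (piw q st ws a b v).
Proof.
elim: ws a v => [|i ws IH] a v vL y; rewrite [X in X != 0]/=.
  case: (a =P b) => _; last by rewrite eqxx.
  by move=> h; have := vL y h; rewrite !mem_box; case: y {h}.
apply: contraNT => yn; rewrite big1 // => c _.
have key m m' y' : y = m :: y' -> (m <= m'.+1)%N ->
    piw q st ws c b (fun z => v (m' :: z)) y' = 0.
  move=> ey mm'; apply/eqP; apply: contraNT yn => h.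
  have [m'L|m'L] := leqP m' L; last first.
    have z0 : (fun z => v (m' :: z)) = fun=> 0.
      apply/funext => z; apply/eqP; apply: contraT => /(vL (m' :: z)).
      by rewrite mem_box /= => /and3P[_]; rewrite leqNgt m'L.
    by move: h; rewrite z0 linop0 ?eqxx //; apply: linop_piw.
  have : y' \in box (size ws) L.+1.
    apply: IH h => z h; have := vL (m' :: z) h; rewrite !mem_box /= eqSS => /and3P[-> _ ->] //.
  by rewrite ey !mem_box /= eqSS => /andP[-> ->]; rewrite (leq_trans mm').
case: y {yn} key => // m y key /=.
case: (if st then _ else _) => //=; first by rewrite (key m).
- by rewrite (key m m.+1) ?mulr0 // ltnW.
- case: m key => // m key; by rewrite (key m.+1 m) ?mulr0.
- by rewrite (key m) ?mulr0.
- by rewrite (key m) ?mulr0.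
Qed.

(* The grading of the module: [piw q true ws a b] has degree [b - w^-1 a],
   where degrees are doubled to stay in the lattice Z^n. *)
Lemma piw_deg ws a b z y : size z = size ws -> piw q true ws a b (delta R z) y != 0 ->
  size y = size ws /\
  forall j, deg ws y j *+ 2 + wact (rev ws) (sgn_weight a) j
          = deg ws z j *+ 2 + sgn_weight b j.
Proof.
elim: ws a z y => [|i ws IH] a [|m z] y //.
  move=> _ /=; case: (a =P b) => [->|_]; last by rewrite eqxx.
  by rewrite /delta; case: (y =P [::]) => [-> //|_]; last by rewrite eqxx.
move=> /succn_inj sz; rewrite delta_cons.
pose g := wact (rev ws) (simple_root i).
have wE : wact (rev (i :: ws)) (sgn_weight a) =
    fun j => wact (rev ws) (sgn_weight a) j + (- (hwt i a *+ 2)) * g j.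
  by rewrite wact_rev_cons sref_sgn_weight wact_lin.
have wE' : wact (rev (i :: ws)) (sgn_weight a) = wact (rev ws) (sgn_weight (spartner i a)).
  by rewrite wact_rev_cons sgn_weight_spartner.
have key c (m' k : nat) : consv m' (piw q true ws c b (delta R z)) y != 0 ->
  (forall j, m'%:Z * g j *+ 2 + wact (rev (i :: ws)) (sgn_weight a) j =
             m%:Z * g j *+ 2 + wact (rev ws) (sgn_weight c) j) ->
  size y = (size ws).+1 /\
  forall j, deg (i :: ws) y j *+ 2 + wact (rev (i :: ws)) (sgn_weight a) j
          = deg (i :: ws) (m :: z) j *+ 2 + sgn_weight b j.
  case: y => [|m1 y] /=; first by rewrite eqxx.
  case: (m1 =P m') => [->|_]; last by rewrite eqxx.
  move=> /(IH _ _ _ sz)[sy e] e'; split; first by rewrite sy.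
  by move=> j; have := e j; have := e' j; rewrite /= -/g; lia.
have [h|h|h] := hwtP i a.
- rewrite piw_hwt0 // => /key; apply => // j.
  by rewrite wE h mul0rn oppr0 mul0r addr0.
- rewrite piw_hwt1 //.
  have [e1|/key h1 _] := eqVneq (consv m.+1 (piw q true ws a b (delta R z)) y) 0; last first.
    by apply: h1 => // j; rewrite wE h ?intS; ring.
  have [e2|/key h1 _] := eqVneq (consv m (piw q true ws (spartner i a) b (delta R z)) y) 0.
    by rewrite e1 e2 !mulr0 subrr eqxx.
  by apply: h1 => // j; rewrite wE'.
rewrite piw_hwtN1 //.
have [e2|/key h1 _] := eqVneq (consv m (piw q true ws (spartner i a) b (delta R z)) y) 0; last first.
  by apply: h1 => // j; rewrite wE'.
rewrite e2 mulr0 addr0.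
case: m key {e2} => [|m] key; first by rewrite eqxx.
have [e1|/key h1 _] := eqVneq (consv m (piw q true ws a b (delta R z)) y) 0.
  by rewrite e1 mulr0 eqxx.
by apply: h1 => // j; rewrite wE h ?intS; ring.
Qed.

Lemma in_span_piw_delta ws a b z : size z = size ws ->
  in_span (fun u => exists y, [/\ size y = size ws,
    (forall j, deg ws y j *+ 2 + wact (rev ws) (sgn_weight a) j
             = deg ws z j *+ 2 + sgn_weight b j) & u = delta R y])
    (piw q true ws a b (delta R z)).
Proof.
move=> sz; have : supp_box (size ws) (\max_(m <- z) m) (delta R z).
  move=> y; rewrite /delta; case: (y =P z) => [->|]; last by rewrite eqxx.
  rewrite mem_box sz eqxx /= => _; apply/allP => m mz.
  exact: (leq_bigmax_seq (F := id)).
move=> /(@piw_box true ws a b) /in_span_delta; apply: in_span_trans => _ [y /(piw_deg sz)[sy e] ->].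
by apply: in_span_mem; exists y.
Qed.

Lemma piw_vacuum_neq0 ws a b : wact (rev ws) (sgn_weight a) = sgn_weight b ->
  piw q true ws a b (delta R (nseq (size ws) 0%N)) (nseq (size ws) 0%N) != 0.
Proof.
elim: ws a => [|i ws IH] a.
  by move=> /sgn_weight_inj ->; rewrite /= eqxx /delta eqxx oner_eq0.
rewrite wact_rev_cons -sgn_weight_spartner [size _]/= [nseq _ _]/= delta_cons.
have [h|h|h] := hwtP i a.
- have -> : spartner i a = a.
    by apply: sgn_weight_inj; rewrite sgn_weight_spartner sref_sgn_weight h;
       apply/funext => j; rewrite mul0rn oppr0 mul0r addr0.
  by rewrite piw_hwt0 // => /IH.
- by rewrite piw_hwt1 //= mulr0 sub0r oppr_eq0 => /IH; apply: mulf_neq0; apply: qpow_neq0.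
- by rewrite piw_hwtN1 //= add0r => /IH; apply: mulf_neq0; apply: qpow_neq0.
Qed.

Definition lower_images ws (d : 'I_n -> int) : vec R -> Prop := fun u =>
  exists a b z, [/\ size z = size ws, u = piw q true ws a b (delta R z),
    (forall j, deg ws z j *+ 2 = d j *+ 2 + wact (rev ws) (sgn_weight a) j - sgn_weight b j)
    & height (deg ws z) < height d].

Lemma height_deg_cons i ws m z : height (deg (i :: ws) (m :: z)) =
  height (deg ws z) + m%:Z * height (wact (rev ws) (simple_root i)).
Proof. exact: height_lin. Qed.

Lemma wact_rev_cons_sgn_weight i ws a : wact (rev (i :: ws)) (sgn_weight a) =
  fun j => wact (rev ws) (sgn_weight a) j
           + (- (hwt i a *+ 2)) * wact (rev ws) (simple_root i) j.
Proof. by rewrite wact_rev_cons sref_sgn_weight wact_lin. Qed.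

(* Unitarity of the fundamental corepresentation of SU_q(2) lets one recover
   [1 (x) x^c_b] from the pair [x^c_b], [x^{s_i c}_b] acting on both factors. *)
Lemma consv_piw_hwt1 i ws c b m z : hwt i c = 1 ->
  consv m (piw q true ws c b (delta R z)) = fun y =>
    ((qpar q i) ^+ m)%:C * piw q true (i :: ws) (spartner i c) b (delta R (m :: z)) y
    + (if m is m'.+1 then
         rsqrt (qpar q i) m * piw q true (i :: ws) c b (delta R (m' :: z)) y else 0).
Proof.
move=> h; have h' : hwt i (spartner i c) = -1 by rewrite hwt_spartner h.
apply/funext => y; rewrite delta_cons piw_hwtN1 // spartnerK.
case: m => [|m]; first by rewrite expr0 add0r !mul1r addr0.
rewrite delta_cons piw_hwt1 //.
have e := rsqrt_sqr i m.+1.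
move: (consv m.+1 _ y) (consv m _ y) => X Y.
apply/esym; transitivity ((rsqrt (qpar q i) m.+1 * rsqrt (qpar q i) m.+1
  + ((qpar q i) ^+ m.+1)%:C * ((qpar q i) ^+ m.+1)%:C) * X); first by ring.
by rewrite e subrK mul1r.
Qed.

Lemma consv_piw_hwtN1 i ws c b m z : hwt i c = -1 ->
  consv m (piw q true ws c b (delta R z)) = fun y =>
    (((qpar q i) ^+ m.+1)%:C^-1 * rsqrt (qpar q i) m.+1) *
       consv m.+1 (piw q true ws (spartner i c) b (delta R z)) y
    + - ((qpar q i) ^+ m.+1)%:C^-1 *
       piw q true (i :: ws) (spartner i c) b (delta R (m :: z)) y.
Proof.
move=> h; have h' : hwt i (spartner i c) = 1 by rewrite hwt_spartner h opprK.
apply/funext => y; rewrite delta_cons piw_hwt1 // spartnerK.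
have := qpow_neq0 i m.+1.
move: (consv m.+1 _ y) (consv m _ y) (((qpar q i) ^+ m.+1)%:C) => X Y Q Q0.
by field.
Qed.

Lemma in_span_lower_images ws y : reduced_word ws -> size y = size ws ->
  y != nseq (size ws) 0%N ->
  in_span (lower_images ws (deg ws y)) (delta R y).
Proof.
elim: ws y => [|i ws IH] [|m y] // red /succn_inj sy y0.
have red' := reduced_consr red.
pose g := wact (rev ws) (simple_root i).
have g0 : 0 < height g := height_root_pos red.
have main N k z : size z = size ws -> z != nseq (size ws) 0%N ->
    height (deg ws z) < N%:Z ->
    in_span (lower_images (i :: ws) (deg (i :: ws) (k :: z))) (delta R (k :: z)).
  elim: N k z => [|N IHN] k z sz z0 hN.
    by have := height_deg_ge0 z red'; lia.
  rewrite delta_cons; apply: in_span_linop (IH z red' sz z0); first exact: linop_consv.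
  move=> _ [c [b [z' [sz' -> e hz]]]].
  have mem d k' : (forall j, deg (i :: ws) (k' :: z') j *+ 2 =
        deg (i :: ws) (k :: z) j *+ 2 + wact (rev (i :: ws)) (sgn_weight d) j - sgn_weight b j) ->
      (k' <= k)%N ->
      in_span (lower_images (i :: ws) (deg (i :: ws) (k :: z)))
              (piw q true (i :: ws) d b (delta R (k' :: z'))).
    move=> e' kk; apply: in_span_mem; exists d, b, (k' :: z'); split => //=; first by rewrite sz'.
    have := height_deg_cons i ws k' z'; have := height_deg_cons i ws k z; rewrite /= -/g => -> ->.
    by apply: ltr_leD => //; apply: ler_wpM2r; [exact: ltW|].
  have [h|h|h] := hwtP i c.
  - rewrite -(piw_hwt0 ws b k _ h) -delta_cons; apply: mem => // j.
    by rewrite wact_rev_cons_sgn_weight h; have := e j; rewrite /=; lia.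
  - rewrite (consv_piw_hwt1 _ _ _ _ h); apply: in_spanZD.
      apply: mem => // j; rewrite wact_rev_cons sgn_weight_spartner srefK.
      by have := e j; rewrite /=; lia.
    case: k mem => [|k] mem; first exact: in_span0.
    apply/in_spanZ/mem => // j; rewrite wact_rev_cons_sgn_weight h.
    by have := e j; rewrite /= intS; lia.
  rewrite (consv_piw_hwtN1 _ _ _ _ h); apply: in_spanZD; last first.
    apply/in_spanZ/mem => // j; rewrite wact_rev_cons sgn_weight_spartner srefK.
    by have := e j; rewrite /=; lia.
  apply: in_span_linop (in_span_piw_delta _ _ sz'); first exact: linop_consv.
  move=> _ [w [sw ew ->]]; rewrite -delta_cons.
  have ew' : deg ws w = fun j => deg ws z j + -1 * g j.
    apply/funext => j; have := e j; have := ew j.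
    rewrite sgn_weight_spartner -wact_rev_cons wact_rev_cons_sgn_weight h -/g; lia.
  have -> : deg (i :: ws) (k :: z) = deg (i :: ws) (k.+1 :: w).
    by apply/funext => j; rewrite /= ew' -/g intS; ring.
  apply: IHN => //; last by rewrite ew' height_lin; lia.
  apply/eqP => w0; apply: (deg_neq_root (y := z) red) => j.
  have : deg ws w j = 0.
    by rewrite w0; elim: (ws) => //= ? ? ->; rewrite mul0r addr0.
  by rewrite ew' -/g; lia.
have [y0'|y0'] := eqVneq y (nseq (size ws) 0%N); last first.
  by apply: (main `|height (deg ws y)|.+1) => //; lia.
case: m y0 => [|m] y0; first by move: y0; rewrite y0' eqxx.
have [a ha] := exists_hwt1 i.
have [b eb] := exists_wact_sgn_weight ws a.
pose x := piw q true ws a b (delta R y) y.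
have x0 : x != 0 by rewrite /x y0'; apply: (piw_vacuum_neq0); rewrite eb.
have degy j : deg ws y j = 0.
  by rewrite y0'; elim: (ws) => //= ? ? ->; rewrite mul0r addr0.
have ex : piw q true ws a b (delta R y) = fun w => x * delta R y w.
  apply/funext => w; rewrite /delta; have [->|wy] := eqVneq w y; first by rewrite mulr1.
  rewrite mulr0; apply/eqP; apply: contraNT wy => /(piw_deg sy)[sw ew].
  apply/eqP; rewrite y0'; apply: height_deg_eq0 => //.
  rewrite (_ : deg ws w = fun=> 0) ?height0 //; apply/funext => j.
  by have := ew j; rewrite eb degy; lia.
have ex' : piw q true ws (spartner i a) b (delta R y) = fun=> 0.
  apply/funext => w; apply/eqP; apply: contraT => /(piw_deg sy)[sw ew].
  exfalso; apply: (deg_neq_root (y := w) red) => j.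
  have := ew j; rewrite sgn_weight_spartner -wact_rev_cons wact_rev_cons_sgn_weight ha.
  by rewrite eb degy -/g; lia.
have -> : delta R (m.+1 :: y) = fun w =>
    (x^-1 * (rsqrt (qpar q i) m.+1)^-1) * piw q true (i :: ws) a b (delta R (m :: y)) w.
  apply/funext => w; rewrite [X in piw _ _ _ _ _ X]delta_cons piw_hwt1 // ex ex'.
  rewrite delta_cons; have := rsqrt_neq0 i m; move: (rsqrt _ _) => s s0.
  case: w => [|k w] /=; first by rewrite !mulr0 subr0 mulr0.
  case: (k == m.+1); case: (k == m); rewrite ?mulr0 ?subr0 ?mulr0 //.
    by rewrite -mulrA !mulKf.
  by rewrite -mulrA !mulKf.
apply/in_spanZ/in_span_mem; exists a, b, (m :: y); split => //; first exact: (congr1 succn sy).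
  move=> j; have := congr1 (fun f => f j) (wact_rev_cons_sgn_weight i ws a).
  by rewrite /= ha eb degy intS => ->; ring.
have := height_deg_cons i ws m y; have := height_deg_cons i ws m.+1 y; rewrite /= -/g => -> ->.
by rewrite intS mulrDl; lia.
Qed.
End Piw.

(** * Growth *)

Section Dimension.
Local Open Scope complex_scope.
Variable R : realType.
Local Notation C := R[i].
Implicit Types (u v : vec R) (S : vec R -> Prop).

Lemma in_span_supp (s : seq (seq nat)) S v :
  (forall u, S u -> forall y, u y != 0 -> y \in s) -> in_span S v ->
  forall y, v y != 0 -> y \in s.
Proof.
move=> Ss [m [c [u [Su ->]]]] y; apply: contraNT => ys.
rewrite /vcomb big1 // => j _; apply/eqP; rewrite mulf_eq0; apply/orP; right.
by apply: contraNT ys; apply: Ss.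
Qed.

Lemma lin_indep_le_supp (s : seq (seq nat)) m (u : 'I_m -> vec R) :
  lin_indep u -> (forall j y, u j y != 0 -> y \in s) -> (m <= size s)%N.
Proof.
move=> indep us; rewrite leqNgt; apply/negP => sm.
pose A := \matrix_(j < m, l < size s) u j (nth [::] s l).
have : kermx A != 0.
  rewrite kermx_eq0 /row_free; apply: contraTN sm => /eqP <-.
  by rewrite -leqNgt rank_leq_col.
case/matrix0Pn => k [j]; apply/negP; rewrite negbK; apply/eqP.
apply: (indep (fun j => kermx A k j)); apply/funext => y; rewrite /vcomb.
have [ys|ys] := boolP (y \in s); last first.
  rewrite big1 // => l _; apply/eqP; rewrite mulf_eq0; apply/orP; right.
  by apply: contraNT ys; apply: us.
have iy : (index y s < size s)%N by rewrite index_mem.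
have := congr1 (fun B => fun_of_matrix B k (Ordinal iy)) (mulmx_ker A).
rewrite mxE [RHS]mxE => e; rewrite -[RHS]e.
by apply: eq_bigr => l _; congr (_ * _); rewrite mxE nth_index.
Qed.

Lemma lin_indep_inj m d (f : 'I_m -> 'I_d) (u : 'I_d -> vec R) :
  injective f -> lin_indep u -> lin_indep (fun j => u (f j)).
Proof.
move=> finj indep c c0 j.
have := indep (fun i => \sum_(l | f l == i) c l); rewrite [vcomb _ _](_ : _ = fun=> 0).
  move=> /(_ erefl (f j)) <-; rewrite (bigD1 j) //= big1 ?addr0 // => l /andP[/eqP/finj -> ].
  by rewrite eqxx.
rewrite -[RHS]c0; apply/funext => y; rewrite /vcomb.
rewrite [RHS](partition_big f xpredT) //=; apply: eq_bigr => i _.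
by rewrite mulr_suml; apply: eq_bigr => l /eqP ->.
Qed.

Lemma lin_indep_delta m (f : 'I_m -> seq nat) :
  injective f -> lin_indep (fun j => delta R (f j)).
Proof.
move=> finj c /(congr1 (fun g => g (f _))) c0 j; have := c0 j.
rewrite /vcomb (bigD1 j) //= /delta eqxx mulr1 big1 ?addr0 // => l lj.
by rewrite (inj_eq finj) eq_sym (negbTE lj) mulr0.
Qed.

Definition dim_bounded S N := forall d (u : 'I_d -> vec R),
  (forall j, in_span S (u j)) -> lin_indep u -> (d <= N)%N.

Lemma dim_span_le S N : dim_bounded S N -> (Defs.dim_span S <= N)%N.
Proof.
by rewrite /Defs.dim_span => SN; case: xgetP => [d _ [[u [iu Su]] _]|_ //]; apply: SN iu.
Qed.

Lemma dim_span_ge S N d (u : 'I_d -> vec R) : dim_bounded S N ->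
  (forall j, in_span S (u j)) -> lin_indep u -> (d <= Defs.dim_span S)%N.
Proof.
move=> SN Su iu.
pose P d := `[< exists u : 'I_d -> vec R, lin_indep u /\ forall j, in_span S (u j) >].
have exP : exists d, P d by exists d; apply/asboolP; exists u.
have boundP m : P m -> (m <= N)%N.
  by move=> /asboolP[v [iv Sv]]; apply: SN iv.
have [m /asboolP Pm mmax] := ex_maxnP exP boundP.
have ex : exists d : nat, (exists u : 'I_d -> vec R, lin_indep u /\ forall j, in_span S (u j)) /\
     (forall u : 'I_d.+1 -> vec R, (forall j, in_span S (u j)) -> ~ lin_indep u).
  exists m; split => // v Sv iv.
  have : P m.+1 by apply/asboolP; exists v.
  by move=> /mmax; rewrite ltnn.
have [_ nind] := xgetPex 0%N ex; rewrite leqNgt; apply/negP => lt.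
apply: (nind (fun j => u (widen_ord lt j))) => //.
by apply: lin_indep_inj iu => j l /(congr1 val) /= /val_inj.
Qed.

End Dimension.

Section Limsup.
Import numFieldNormedType.Exports.
Variable R : realType.
Local Open Scope classical_set_scope.

Lemma le_limn_esup (u v : nat -> \bar R) :
  (\forall r \near \oo, u r <= v r)%E -> (limn_esup u <= limn_esup v)%E.
Proof.
move=> uv; apply: le_ereal_inf_tmp => /= _ [V FV <-].
apply: (@le_trans _ _ (ereal_sup (u @` (V `&` [set r | (u r <= v r)%E])))).
  apply: ereal_inf_lbound => /=; exists (V `&` [set r | (u r <= v r)%E]) => //.
  exact: filterI.
apply: ge_ereal_sup => _ [r [Vr uvr] <-].
by apply: le_trans uvr _; apply: ereal_sup_ubound; exists r.
Qed.

Lemma cvg_ln_nat : (ln (r%:R : R) @[r --> \oo] --> +oo)%R.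
Proof.
apply/cvgryPge => A; have /cvgryPge/(_ (expR A)) := @cvgr_idn R.
apply: filterS => r Ar; rewrite -[A]expRK ler_ln ?posrE ?expR_gt0 //.
exact: lt_le_trans (expR_gt0 A) Ar.
Qed.

Lemma limn_esup_const_add_ln (k c : R) :
  limn_esup (fun r : nat => (k + c / ln r%:R)%:E) = k%:E.
Proof.
apply: (cvg_limn_einf_sup _).2; apply/fine_cvgP; split; first by near=> r.
rewrite -[X in _ --> X]addr0; apply: cvgD; first exact: cvg_cst.
rewrite -[X in _ --> X](mulr0 c); apply: cvgM; first exact: cvg_cst.
apply/gtr0_cvgV0; last exact: cvg_ln_nat.
near=> r; apply: ln_gt0; rewrite ltr1n; near: r; exact: nbhs_infty_gt.
Unshelve. all: by end_near. Qed.

Lemma limn_esup_ln_le (d : nat -> nat) (k K : nat) : (0 < K)%N ->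
  (forall r, (0 < r)%N -> (d r <= (K * r) ^ k)%N) ->
  (limn_esup (fun r => (ln ((d r)%:R : R) / ln r%:R)%:E) <= (k%:R)%:E)%E.
Proof.
move=> K0 dr; rewrite -(limn_esup_const_add_ln k%:R (k%:R * ln K%:R)).
apply: le_limn_esup; near=> r.
have r1 : (1 < r)%N by near: r; exact: nbhs_infty_gt.
have lr : 0 < ln (r%:R : R) by rewrite ln_gt0 // ltr1n.
rewrite lee_fin ler_pdivrMr // mulrDl mulfVK ?gt_eqF //.
have K1 : 0 <= ln (K%:R : R) by rewrite ln_ge0 // ler1n.
have [d0|d0] := posnP (d r).
  by rewrite d0 ln0 // addr_ge0 // mulr_ge0 // ltW.
have Kr0 : 0 < (K%:R * r%:R : R) by rewrite mulr_gt0 ?ltr0n // ltnW.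
rewrite addrC -mulrDr -lnM; last 2 first; [by rewrite posrE ltr0n|by rewrite posrE ltr0n ltnW|].
rewrite [k%:R * _]mulr_natl -lnXn // ler_ln ?posrE ?ltr0n ?exprn_gt0 // -natrM -natrX ler_nat.
exact/dr/ltnW.
Unshelve. all: by end_near. Qed.

Lemma limn_esup_ln_ge (d : nat -> nat) (k K : nat) : (0 < K)%N ->
  (forall r, (0 < r)%N -> (r ^ k <= K ^ k * d r)%N) ->
  ((k%:R)%:E <= limn_esup (fun r => (ln ((d r)%:R : R) / ln r%:R)%:E))%E.
Proof.
move=> K0 dr; rewrite -(limn_esup_const_add_ln k%:R (- (k%:R * ln K%:R))).
apply: le_limn_esup; near=> r.
have r1 : (1 < r)%N by near: r; exact: nbhs_infty_gt.
have lr : 0 < ln (r%:R : R) by rewrite ln_gt0 // ltr1n.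
have d0 : (0 < d r)%N.
  have := leq_trans _ (dr _ (ltnW r1)); move=> /(_ 1%N).
  by rewrite expn_gt0 (ltnW r1) /= muln_gt0 => /(_ isT) /andP[].
rewrite lee_fin ler_pdivlMr // mulrDl mulfVK ?gt_eqF //.
have r0 : 0 < (r%:R : R) by rewrite ltr0n ltnW.
have KR0 : 0 < (K%:R : R) by rewrite ltr0n.
rewrite lerBlDr !mulr_natl -!lnXn // -lnM ?posrE ?exprn_gt0 ?ltr0n //.
rewrite -!natrX -natrM ler_ln ?posrE ?ltr0n ?muln_gt0 ?expn_gt0 ?K0 ?d0 ?(ltnW r1) //.
by rewrite ler_nat mulnC dr // ltnW.
Unshelve. all: by end_near. Qed.

End Limsup.

Section Words.
Local Open Scope complex_scope.
Variable R : realType.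
Local Notation C := R[i].
Implicit Types (u v : vec R).

Lemma opwordS r (T : 'I_r.+1 -> op R) :
  opword T = T ord0 \o opword (fun l => T (lift ord0 l)).
Proof. by rewrite /opword enum_ordSl /= foldr_map. Qed.

Lemma opword0 (T : 'I_0 -> op R) : opword T = id.
Proof. by rewrite /opword; have := size_enum_ord 0; case: (enum _). Qed.

Definition bounded_op k D (T : op R) : Prop :=
  forall L v, supp_box k L v -> supp_box k (L + D) (T v).

Lemma box_leq k L L' y : (L <= L')%N -> y \in box k L -> y \in box k L'.
Proof.
move=> LL; rewrite !mem_box => /andP[-> /allP yL]; apply/allP => m /yL mL.
exact: leq_trans LL.
Qed.

Lemma bounded_opword k D r (T : 'I_r -> op R) :
  (forall l, bounded_op k D (T l)) -> bounded_op k (r * D) (opword T).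
Proof.
elim: r T => [|r IH] T bT L v vL; first by rewrite opword0 addn0.
by rewrite opwordS mulSn addnC -addnA addnC; apply/bT; rewrite addnC; apply: IH.
Qed.

Lemma supp_box_c00k k L v : supp_box k L v -> c00k k v.
Proof.
move=> vL; exists (box k L); split=> y sy; last first.
  by apply/eqP; apply: contraT => /vL; rewrite mem_box => /andP[/eqP /sy].
by move=> ys; apply/eqP; apply: contraNT ys; apply: vL.
Qed.

Lemma c00k_supp_box k v : c00k k v -> exists L, supp_box k L v.
Proof.
move=> [s [s1 s2]]; exists (\max_(y <- s) \max_(m <- y) m)%N => y y0.
have sy : size y = k by apply: contra_neqP y0 => /s2.
have ys : y \in s by apply: contraNT y0 => ys; apply/eqP/s1.
rewrite mem_box sy eqxx /=; apply/allP => m my.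
apply: leq_trans (leq_bigmax_seq (P := xpredT) (F := fun y => (\max_(m <- y) m)%N) _ ys isT).
exact: (leq_bigmax_seq (F := id)).
Qed.

Lemma in_alg_bounded k (I : finType) (gen : I -> op R) D (T : op R) :
  (forall j, bounded_op k D (gen j)) -> Defs.in_alg (c00k k) gen T ->
  exists D', bounded_op k D' T.
Proof.
move=> bg [m [c [len [w e]]]]; exists (\max_(j < m) (len j * D))%N => L v vL y.
rewrite e; last exact: supp_box_c00k vL.
apply: contraNT => yn; rewrite big1 // => j _; apply/eqP; rewrite mulf_eq0; apply/orP; right.
apply: contraNT yn => /(bounded_opword (fun l => bg (w j l)) vL); apply: box_leq.
by rewrite leq_add2l (leq_bigmax (F := fun j => len j * D)%N j).
Qed.

Lemma in_alg_word (M : vec R -> Prop) (I : finType) (gen : I -> op R) r (g : 'I_r -> I)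
  (T : op R) : T = opword (fun l => gen (g l)) -> Defs.in_alg M gen T.
Proof.
move=> ->; exists 1%N, (fun=> 1), (fun=> r), (fun=> g) => f _.
by apply/funext => y; rewrite big_ord1 mul1r.
Qed.

Definition words p (xi : 'I_p -> op R) s (w : 'I_s -> vec R) r : vec R -> Prop :=
  fun u => exists (g : 'I_r -> 'I_p) (j : 'I_s), u = opword (fun l => xi (g l)) (w j).

Lemma words_cons p (xi : 'I_p -> op R) s (w : 'I_s -> vec R) r i u :
  words xi w r u -> words xi w r.+1 (xi i u).
Proof.
move=> [g [j ->]]; exists (fun l => if unlift ord0 l is Some k then g k else i), j.
rewrite opwordS /= unlift_none; congr (xi i (opword _ _)).
by apply/funext => l; rewrite liftK.
Qed.

Lemma dim_bounded_supp (s : seq (seq nat)) (S : vec R -> Prop) :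
  (forall u, S u -> forall y, u y != 0 -> y \in s) -> dim_bounded S (size s).
Proof.
by move=> Ss d u Su /lin_indep_le_supp; apply => j; apply: in_span_supp (Su j).
Qed.

Lemma dim_bounded_words k p (xi : 'I_p -> op R) s (w : 'I_s -> vec R) D L r :
  (forall i, bounded_op k D (xi i)) -> (forall j, supp_box k L (w j)) ->
  dim_bounded (words xi w r) ((L + r * D).+1 ^ k).
Proof.
move=> xiD wL; rewrite -size_box; apply: dim_bounded_supp => _ [g [j ->]].
by apply: bounded_opword => // l.
Qed.

End Words.

Section GelfandKirillov.
Local Open Scope complex_scope.
Variables (R : realType) (q : R) (n : nat) (t : 'I_n -> R[i]) (ws : seq 'I_n).
Hypothesis q01 : 0 < q < 1.
Hypothesis t1 : forall j, `|t j| = 1.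
Hypothesis red : reduced_word ws.
Let k := size ws.

Lemma linop_spin_gen g : linop (spin_gen q t ws g).
Proof.
move: g => [[a b] st] c u v; apply/funext => y /=.
by rewrite linop_piw; case: st; ring.
Qed.

Lemma spin_gen_bounded g : bounded_op k 1 (spin_gen q t ws g).
Proof.
move: g => [[a b] st] L v vL y; rewrite addn1 mulf_eq0 negb_or => /andP[_].
exact: piw_box.
Qed.

Lemma GKdim_VSpin_le : (GKdim_VSpin q t ws <= (k%:R)%:E)%E.
Proof.
apply: ge_ereal_sup => _ [p [xi [s [w [[xi_alg _] [wM _] ->]]]]].
have [D xiD] := choice (fun j => in_alg_bounded spin_gen_bounded (xi_alg j)).
have [L wL] := choice (fun j => c00k_supp_box (wM j)).
pose D' := (\max_j D j)%N; pose L' := (\max_j L j)%N.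
apply: (@limn_esup_ln_le _ _ _ (L' + D').+1) => // r r0.
apply: leq_trans (dim_span_le (@dim_bounded_words _ k _ xi _ w D' L' r _ _)) _.
- move=> i u v /(xiD i) h y /h; apply: box_leq.
  by rewrite leq_add2l (leq_bigmax (F := D)).
- by move=> j y /(wL j); apply: box_leq; rewrite (leq_bigmax (F := L)).
have h : ((L' + r * D').+1 <= (L' + D').+1 * r)%N by nia.
by case: (k) => // k'; rewrite leq_exp2r.
Qed.

Let gens := (spin n * spin n * bool)%type.

Definition id_spin_gen (j : 'I_(#|{: gens}|.+1)) : op R :=
  if unlift ord0 j is Some l then spin_gen q t ws (enum_val l) else id.

Definition vacuum (j : 'I_1) : vec R := delta R (nseq k 0%N).

Lemma linop_id_spin_gen j : linop (id_spin_gen j).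
Proof. by rewrite /id_spin_gen; case: unlift => [l|] //; apply: linop_spin_gen. Qed.

Lemma id_spin_gen_bounded j : bounded_op k 1 (id_spin_gen j).
Proof.
rewrite /id_spin_gen; case: unlift => [l|]; first exact: spin_gen_bounded.
by move=> L v vL y /vL; apply: box_leq; rewrite addn1.
Qed.

Lemma id_spin_gen_lift g : id_spin_gen (lift ord0 (enum_rank g)) = spin_gen q t ws g.
Proof. by rewrite /id_spin_gen liftK enum_rankK. Qed.

Lemma gen_subset_id_spin_gen M : gen_subset M (spin_gen q t ws) id_spin_gen.
Proof.
split; [|split].
- move=> j; rewrite /id_spin_gen; case: unlift => [l|].
    apply: (@in_alg_word _ _ _ _ 1 (fun=> enum_val l)).
    by rewrite opwordS opword0.
  have g : 'I_0 -> gens by case.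
  by apply: (@in_alg_word _ _ _ _ 0 g); rewrite opword0.
- move=> T [m [c [len [w e]]]].
  exists m, c, len, (fun j l => lift ord0 (enum_rank (w j l))) => f Mf.
  rewrite e //; apply/funext => y; apply: eq_bigr => j _; congr (_ * opword _ _ _).
  by apply/funext => l; rewrite id_spin_gen_lift.
- by exists ord0 => f _; rewrite /id_spin_gen unlift_none.
Qed.

Lemma tpow_neq0 a : tpow t a != 0.
Proof.
rewrite /tpow prodf_seq_neq0; apply/allP => j _ /=.
by rewrite expfz_neq0 // -normr_eq0 t1 oner_eq0.
Qed.

Lemma delta_in_words r y : size y = k -> height (deg ws y) <= r%:Z ->
  in_span (words id_spin_gen vacuum r) (delta R y).
Proof.
have zero y' : size y' = k -> height (deg ws y') <= 0 -> y' = nseq k 0%N.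
  move=> sy hy; apply: height_deg_eq0 => //; apply/eqP; rewrite eq_le hy.
  exact: height_deg_ge0.
elim: r y => [|r IH] y sy hy.
  apply: in_span_mem; have g : 'I_0 -> 'I_(#|{: gens}|.+1) by case.
  by exists g, ord0; rewrite opword0 (zero y).
have [->|y0] := eqVneq y (nseq k 0%N).
  have -> : delta R (nseq k 0%N) = id_spin_gen ord0 (delta R (nseq k 0%N)).
    by rewrite /id_spin_gen unlift_none.
  apply: in_span_linop (IH (nseq k 0%N) _ _); first exact: linop_id_spin_gen.
  - by move=> u /words_cons wu; apply: in_span_mem.
  - exact: size_nseq.
  - suff -> : deg ws (nseq k 0%N) = fun=> 0 by rewrite height0.
    apply/funext => j; rewrite /k; elim: (ws) => //= ? ? ->; by rewrite mul0r addr0.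
apply: in_span_trans (in_span_lower_images q01 red sy y0) => _ [a [b [z [sz -> _ hz]]]].
have -> : piw q true ws a b (delta R z) = fun x =>
    ((tpow t a)^* )^-1 * id_spin_gen (lift ord0 (enum_rank (a, b, true))) (delta R z) x.
  apply/funext => x; rewrite id_spin_gen_lift /= mulKf // conjc_eq0; exact: tpow_neq0.
apply: in_spanZ; apply: in_span_linop (IH z sz _); first exact: linop_id_spin_gen.
  by move=> u /words_cons wu; apply: in_span_mem.
lia.
Qed.

Lemma opword_id_spin_gen r (g : 'I_r -> _) : exists r' (g' : 'I_r' -> gens),
  opword (fun l => id_spin_gen (g l)) = opword (fun l => spin_gen q t ws (g' l)).
Proof.
elim: r g => [|r IH] g.
  have g' : 'I_0 -> gens by case.
  by exists 0%N, g'; rewrite !opword0.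
have [r' [g' e]] := IH (fun l => g (lift ord0 l)).
rewrite opwordS e /id_spin_gen; case: unlift => [l|]; last by exists r', g'.
exists r'.+1, (fun l0 => if unlift ord0 l0 is Some l' then g' l' else (enum_val l : gens)).
rewrite opwordS unlift_none; congr (_ \o opword _).
by apply/funext => l'; rewrite liftK.
Qed.

Lemma gen_space_vacuum : gen_space (c00k k) (spin_gen q t ws) vacuum.
Proof.
split=> [j|v /c00k_supp_box[L vL]].
  apply: (@supp_box_c00k _ _ 0) => y; rewrite /vacuum /delta.
  case: (y =P nseq k 0%N) => [->|_]; last by rewrite eqxx.
  by rewrite mem_box size_nseq eqxx /= all_nseq leqnn orbT.
apply: in_span_trans (in_span_delta vL) => _ [y /vL + ->].
rewrite mem_box => /andP[/eqP sy _].
have : height (deg ws y) <= (`|height (deg ws y)|%N)%:Z by lia.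
move=> /(delta_in_words sy); apply: in_span_trans => _ [g [j ->]].
apply: in_span_mem; exists (opword (fun l => id_spin_gen (g l))), j; split => //.
have [r' [g' ->]] := opword_id_spin_gen g.
exact: in_alg_word.
Qed.

Lemma height_deg_le (ws' : seq 'I_n) N y : reduced_word ws' -> size y = size ws' ->
  all (fun m => m <= N)%N y ->
  height (deg ws' y) <= N%:Z * height (deg ws' (nseq (size ws') 1%N)).
Proof.
elim: ws' y => [|i ws' IH] [|m y] red' //; first by rewrite /= height0 mulr0.
move=> /succn_inj sy /= /andP[mN yN]; rewrite !height_lin mulrDr.
apply: lerD; first exact: IH (reduced_consr red') sy yN.
by rewrite mul1r; apply: ler_wpM2r => //; apply/ltW/height_root_pos.
Qed.

Lemma uniq_box k' N : uniq (box k' N).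
Proof.
elim: k' => // k' IH; rewrite boxS; apply: allpairs_uniq; rewrite ?iota_uniq //.
by move=> [m y] [m' y'] _ _ /= [-> ->].
Qed.

Lemma GKdim_VSpin_ge : ((k%:R)%:E <= GKdim_VSpin q t ws)%E.
Proof.
pose H := height (deg ws (nseq k 1%N)).
have H0 : 0 <= H := height_deg_ge0 _ red.
apply: le_trans (ereal_sup_ubound _); last first.
  exists _, id_spin_gen, 1%N, vacuum; split; [exact: gen_subset_id_spin_gen|exact: gen_space_vacuum|by []].
apply: (@limn_esup_ln_ge _ _ _ `|H|.+1) => // r r0.
pose N := (r %/ `|H|.+1)%N.
have rN : (r <= `|H|.+1 * N.+1)%N by rewrite mulnC ltnW // ltn_ceil.
apply: (@leq_trans ((`|H|.+1 * N.+1) ^ k)%N); first by case: (k) => // k'; rewrite leq_exp2r.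
rewrite expnMn leq_pmul2l ?expn_gt0 // -size_box.
pose u (j : 'I_(size (box k N))) := delta R (nth [::] (box k N) j).
apply: (@dim_span_ge _ _ ((0 + r * 1).+1 ^ k)%N _ u).
- apply: dim_bounded_words => [j|j]; first exact: id_spin_gen_bounded.
  move=> y; rewrite /vacuum /delta; case: (y =P nseq k 0%N) => [->|_]; last by rewrite eqxx.
  by rewrite mem_box size_nseq eqxx /= all_nseq leqnn orbT.
- move=> j; have := mem_nth [::] (ltn_ord j); rewrite mem_box => /andP[/eqP sy yN].
  apply: delta_in_words => //; apply: le_trans (height_deg_le red sy yN) _.
  have NH : (N * `|H| <= r)%N by rewrite (leq_trans _ (leq_divM r `|H|.+1)) // leq_mul2l leqnSn orbT.
  by rewrite -/k -/H -[H]gez0_abs // -PoszM lez_nat.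
- apply: lin_indep_delta => j l /eqP; rewrite nth_uniq ?uniq_box // => /eqP.
  exact: val_inj.
Qed.

End GelfandKirillov.

Unset Implicit Arguments.

Theorem theorem4p8 (R : realType) (n : nat) (q : R) (t : 'I_n -> R[i])
  (ws : seq 'I_n) :
  (0 < n)%N -> 0 < q < 1 -> (forall j, `|t j| = 1) -> reduced_word ws ->
  GKdim_VSpin q t ws = ((size ws)%:R)%:E.
Proof.
move=> _ q01 t1 red; apply/eqP; rewrite eq_le GKdim_VSpin_le //.
exact: GKdim_VSpin_ge.
Qed.
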